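(* Let $\Gamma$ be a finite graph which is a Cayley sum graph, or a twisted Cayley graph, or a twisted Cayley sum graph, or a vertex-transitive graph. Let $d$ denote the degree of $\Gamma$. Assume that $\Gamma$ is undirected and non-bipartite. Then $$\beta_{\mathrm{edge},\Gamma}\ \ge\ \frac{\mathfrak{h}_\Gamma}{90\,d}\qquad\text{and}\qquad \beta_{\mathrm{vert},\Gamma}\ \ge\ \frac{h_\Gamma}{135}.$$
   Context: Graphs may have loops (and multiple edges); a graph on a finite vertex set $V$ is encoded by its adjacency matrix $m:V\times V\to\mathbb{Z}_{\ge 0}$, undirected means $m$ is symmetric, and $d$-regular means $\sum_{u}m(v,u)=d$ for every $v$. For $A,B\subseteq V$ let $|E(A,B)|=\sum_{a\in A,b\in B}m(a,b)$. For $S\subseteq V$, $\mathcal N(S)$ is the set of vertices adjacent to some vertex of $S$, $\partial_{\mathrm{vert}}(S)=\mathcal N(S)\setminus S$, $\partial_{\mathrm{edge}}(S)=E(S,V\setminus S)$. Non-bipartite: there is no partition $V=V_1\sqcup V_2$ with $m(x,y)=0$ whenever $x,y$ lie in the same part. Let $G$ be a finite group, $S\subseteq G$, $\sigma$ an automorphism of $G$. The twisted Cayley graph $C(G,S)^\sigma$ has vertex set $G$, with $y$ adjacent to $x$ iff $y=\sigma(xs)$ for some $s\in S$; the twisted Cayley sum graph $C_\Sigma(G,S)^\sigma$ has $y$ adjacent to $x$ iff $y=\sigma(x^{-1}s)$ for some $s\in S$. The Cayley graph $C(G,S)$ and Cayley sum graph $C_\Sigma(G,S)$ are the cases $\sigma=\mathrm{id}$.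 The degree is $d=|S|$. Edge Cheeger constant: $\mathfrak h_\Gamma=\min\{|\partial_{\mathrm{edge}}(S)|/(d|S|): \emptyset\ne S\subseteq V, |S|\le |V|/2\}$. Vertex Cheeger constant: $h_\Gamma=\min\{|\partial_{\mathrm{vert}}(S)|/|S|: \emptyset\ne S\subseteq V,|S|\le|V|/2\}$. For disjoint $L,R\subseteq V$ with $L\cup R\ne\emptyset$: $\beta_{\mathrm{edge}}(L,R)=\frac{|E(L,R^c)|+|E(R,L^c)|}{d|L\cup R|}$ and $\beta_{\mathrm{vert}}(L,R)=\frac{|L\cap\mathcal N(L)|+|R\cap\mathcal N(R)|+|\partial_{\mathrm{vert}}(L\cup R)|}{|L\cup R|}$; the edge (resp. vertex) bipartiteness constant $\beta_{\mathrm{edge},\Gamma}$ (resp. $\beta_{\mathrm{vert},\Gamma}$) is the minimum of $\beta_{\mathrm{edge}}(L,R)$ (resp. $\beta_{\mathrm{vert}}(L,R)$) over all such pairs. *)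

(* Defs.v *)
From mathcomp Require Import all_boot all_order all_algebra all_fingroup.
Set Implicit Arguments.
Unset Strict Implicit.
Unset Printing Implicit Defensive.
Import Order.TTheory GRing.Theory Num.Theory.
Local Open Scope ring_scope.

Record mgraph : Type := MGraph {
  vertex :> finType;
  mult : vertex -> vertex -> nat }.

Definition undirected (Gam : mgraph) : Prop :=
  forall x y : Gam, mult x y = mult y x.

Definition regular (Gam : mgraph) (d : nat) : Prop :=
  forall x : Gam, (\sum_(y : Gam) mult x y)%N = d.

(* The two parts are A and its complement; either may be empty, so an
   edgeless graph is bipartite and a nonbipartite graph has positive degree. *)
Definition bipartite (Gam : mgraph) : Prop :=
  exists A : {set Gam},
    forall x y : Gam, (x \in A) = (y \in A) -> mult x y = 0%N.

Definition is_graph_iso (Gam Del : mgraph) (f : Gam -> Del) : Prop :=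
  bijective f /\ forall x y : Gam, mult (f x) (f y) = mult x y.

Definition graph_isomorphic (Gam Del : mgraph) : Prop :=
  exists f : Gam -> Del, is_graph_iso f.

Definition vertex_transitive (Gam : mgraph) : Prop :=
  forall x y : Gam, exists f : Gam -> Gam, is_graph_iso f /\ f x = y.

(* For given x and y at most one s satisfies the adjacency equation, so all
   multiplicities are 0 or 1 and the degree is #|S|. *)
Definition twisted_cayley_graph (G : finGroupType) (S : {set G})
    (sigma : {perm G}) : mgraph :=
  @MGraph G (fun x y => nat_of_bool [exists s in S, y == sigma (x * s)%g]).

Definition twisted_cayley_sum_graph (G : finGroupType) (S : {set G})
    (sigma : {perm G}) : mgraph :=
  @MGraph G (fun x y => nat_of_bool [exists s in S, y == sigma (x^-1 * s)%g]).

Definition cayley_sum_graph (G : finGroupType) (S : {set G}) : mgraph :=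
  twisted_cayley_sum_graph S 1%g.

Definition is_cayley_sum_graph (Gam : mgraph) : Prop :=
  exists (G : finGroupType) (S : {set G}),
    graph_isomorphic Gam (cayley_sum_graph S).

Definition is_twisted_cayley_graph (Gam : mgraph) : Prop :=
  exists (G : finGroupType) (S : {set G}) (sigma : {perm G}),
    sigma \in Aut [set: G] /\
    graph_isomorphic Gam (twisted_cayley_graph S sigma).

Definition is_twisted_cayley_sum_graph (Gam : mgraph) : Prop :=
  exists (G : finGroupType) (S : {set G}) (sigma : {perm G}),
    sigma \in Aut [set: G] /\
    graph_isomorphic Gam (twisted_cayley_sum_graph S sigma).

Section Expansion.
Variable Gam : mgraph.
Implicit Types A B L R : {set Gam}.

Definition edge_count A B : nat := \sum_(a in A) \sum_(b in B) mult a b.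

Definition nbhd A : {set Gam} :=
  [set v | [exists u in A, (0 < mult u v)%N]].

Definition vert_boundary A : {set Gam} := nbhd A :\: A.

Definition edge_boundary_size A : nat := edge_count A (~: A).

End Expansion.

(* The minimum of F over P, with junk value 0 when P is empty. *)
Definition min_over (T : finType) (P : pred T) (F : T -> rat) : rat :=
  if [pick x | P x] is Some x0 then F [arg min_(x < x0 | P x) F x]%O else 0.

Lemma min_over_le (T : finType) (P : pred T) (F : T -> rat) (x : T) :
  P x -> min_over P F <= F x.
Proof.
rewrite /min_over; case: pickP => [x0 Px0 | P0] Px; last by rewrite P0 in Px.
by case: arg_minP => // i _; apply.
Qed.

Lemma min_over_attained (T : finType) (P : pred T) (F : T -> rat) (x : T) :
  P x -> exists2 y, P y & min_over P F = F y.
Proof.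
rewrite /min_over; case: pickP => [x0 Px0 | P0] Px; last by rewrite P0 in Px.
by case: arg_minP => // i Pi _; exists i.
Qed.

(* There is an admissible set exactly when #|Gam| >= 2; on a one-vertex graph
   both Cheeger constants take the junk value 0 of min_over. *)
Definition cheeger_set (Gam : mgraph) : pred {set Gam} :=
  fun A => (A != set0) && (2 * #|A| <= #|Gam|)%N.

Definition edge_cheeger (Gam : mgraph) (d : nat) : rat :=
  min_over (@cheeger_set Gam)
    (fun A => (edge_boundary_size A)%:R / (d * #|A|)%:R).

Definition vert_cheeger (Gam : mgraph) : rat :=
  min_over (@cheeger_set Gam)
    (fun A => #|vert_boundary A|%:R / #|A|%:R).

Definition beta_edge (Gam : mgraph) (d : nat) (L R : {set Gam}) : rat :=
  (edge_count L (~: R) + edge_count R (~: L))%:R / (d * #|L :|: R|)%:R.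

Definition beta_vert (Gam : mgraph) (L R : {set Gam}) : rat :=
  (#|L :&: nbhd L| + #|R :&: nbhd R| + #|vert_boundary (L :|: R)|)%:R
    / #|L :|: R|%:R.

Definition bip_pair (Gam : mgraph) : pred ({set Gam} * {set Gam}) :=
  fun LR => [disjoint LR.1 & LR.2] && (LR.1 :|: LR.2 != set0).

Definition edge_bipartiteness (Gam : mgraph) (d : nat) : rat :=
  min_over (@bip_pair Gam) (fun LR => beta_edge d LR.1 LR.2).

Definition vert_bipartiteness (Gam : mgraph) : rat :=
  min_over (@bip_pair Gam) (fun LR => beta_vert LR.1 LR.2).

(* Main.v *)
Require Import Defs.
From mathcomp Require Import all_boot all_order all_algebra all_fingroup.
From mathcomp Require Import zify ring lra.
Set Implicit Arguments.
Unset Strict Implicit.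
Unset Printing Implicit Defensive.
Import Order.TTheory GRing.Theory Num.Theory.
Local Open Scope ring_scope.

(** Let H be the group of pairs (phi, psi) of permutations of the vertices with
    m (phi x) (psi y) = m x y. In each of the four classes H is transitive on
    vertices through phi, and H is stable under swapping phi and psi since m is
    symmetric. If beta(L, R) were small, put f = 1_L - 1_R: expansion makes
    L :|: R almost everything, and for every g in H the set of the x in L with
    phi x in L and the x in R with psi x in R has a small boundary, so it is
    almost empty or almost everything. Hence the correlation of f with
    f o phi and f o psi is close to plus or minus its maximum, and its sign chi
    is a character of H. The average F of chi(g) (f o phi) over H is
    chi-equivariant under both phi and psi, so for O = {F > 0} every vertex has
    the same number c of neighbours on its own side of O. As f nearly agrees
    with the sign of F, all but few edges join the two sides; counting gives
    c = 0, so the graph is bipartite. *)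

(** * Multiplicity-preserving pairs and the four graph classes *)

(* A pair acts on the bipartite double cover by one component on each side. *)
Definition biautomorphisms (Gam : mgraph) : {set {perm Gam} * {perm Gam}} :=
  [set g : {perm Gam} * {perm Gam} | [forall x, forall y, mult (g.1 x) (g.2 y) == mult x y]].

Definition bitransitive (Gam : mgraph) : Prop :=
  forall x y : Gam, exists2 g, g \in biautomorphisms Gam & g.1 x = y.

Lemma biautP (Gam : mgraph) (g : {perm Gam} * {perm Gam}) :
  reflect (forall x y, mult (g.1 x) (g.2 y) = mult x y)
          (g \in biautomorphisms Gam).
Proof.
rewrite inE; apply: (iffP forallP) => H x; first by move=> y; apply/eqP/(forallP (H x)).
by apply/forallP => y; apply/eqP.
Qed.

Lemma bitransitive_fun (Gam : mgraph) :
  (forall x y : Gam, exists phi psi : Gam -> Gam,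
     [/\ injective phi, injective psi,
         forall u v, mult (phi u) (psi v) = mult u v & phi x = y]) ->
  bitransitive Gam.
Proof.
move=> H x y; have [phi [psi [phiI psiI Hm <-]]] := H x y.
exists (perm phiI, perm psiI); last by rewrite /= permE.
by apply/biautP => u v; rewrite /= !permE.
Qed.

Lemma bitransitive_iso (Gam Del : mgraph) :
  graph_isomorphic Gam Del -> bitransitive Del -> bitransitive Gam.
Proof.
move=> [f [[f' fK f'K] Hf]] HD; apply: bitransitive_fun => x y.
have [g /biautP Hg gx] := HD (f x) (f y).
exists (fun u => f' (g.1 (f u))), (fun u => f' (g.2 (f u))).
have f'I := can_inj f'K; have fI := can_inj fK.
split=> [u v /f'I /perm_inj /fI | u v /f'I /perm_inj /fI | u v |] //.
- by rewrite -Hf !f'K Hg Hf.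
- by rewrite gx fK.
Qed.

(** Left translation by [a] in the first component is matched by left translation by [sigma a] in
    the second, since [sigma] is multiplicative. *)
Lemma bitransitive_twisted_cayley (G : finGroupType) (S : {set G})
    (sigma : {perm G}) :
  sigma \in Aut [set: G] -> bitransitive (twisted_cayley_graph S sigma).
Proof.
move=> /Aut_morphic /morphicP sM; apply: bitransitive_fun => x y.
exists (fun u => (y * x^-1 * u)%g), (fun v => (sigma (y * x^-1) * v)%g).
split=> [u v /mulgI | u v /mulgI | u v |] //=; last by rewrite mulgKV.
congr nat_of_bool; apply: eq_existsb => s; congr andb.
by rewrite -[(_ * u * s)%g]mulgA (sM (y * x^-1)%g) ?inE //; exact: (inj_eq (@mulgI G _)).
Qed.

(** Right translation by [a] turns [u^-1 * s] into [a^-1 * u^-1 * s], so its partner is left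
    translation by [sigma a^-1]. The two components are of different kinds, which is why pairs are
    used. *)
Lemma bitransitive_twisted_cayley_sum (G : finGroupType) (S : {set G})
    (sigma : {perm G}) :
  sigma \in Aut [set: G] -> bitransitive (twisted_cayley_sum_graph S sigma).
Proof.
move=> /Aut_morphic /morphicP sM; apply: bitransitive_fun => x y.
exists (fun u => (u * (x^-1 * y))%g), (fun v => (sigma (x^-1 * y)^-1 * v)%g).
split=> [u v /mulIg | u v /mulgI | u v |] //=; last by rewrite mulKVg.
congr nat_of_bool; apply: eq_existsb => s; congr andb.
by rewrite (invMg u) -[(_ * u^-1 * s)%g]mulgA (sM (x^-1 * y)^-1%g) ?inE //; exact: (inj_eq (@mulgI G _)).
Qed.

Lemma bitransitive_vertex_transitive (Gam : mgraph) :
  vertex_transitive Gam -> bitransitive Gam.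
Proof.
move=> vt; apply: bitransitive_fun => x y; have [f [[/bij_inj fI Hf] <-]] := vt x y.
by exists f, f.
Qed.

Lemma bitransitive_class (Gam : mgraph) :
  is_cayley_sum_graph Gam \/ is_twisted_cayley_graph Gam \/
  is_twisted_cayley_sum_graph Gam \/ vertex_transitive Gam ->
  bitransitive Gam.
Proof.
case=> [[G [S iso]] | [[G [S [s [As iso]]]] | [[G [S [s [As iso]]]] | vt]]].
- apply: bitransitive_iso iso _; apply: bitransitive_twisted_cayley_sum.
  exact: group1.
- by apply: bitransitive_iso iso _; apply: bitransitive_twisted_cayley.
- by apply: bitransitive_iso iso _; apply: bitransitive_twisted_cayley_sum.
- exact: bitransitive_vertex_transitive.
Qed.

(** * The sign character and the equivariant average *)

Section SignCharacter.
Variables (Gam : mgraph) (L R : {set Gam}).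
Hypothesis Hund : undirected Gam.
Hypothesis Htr : bitransitive Gam.
Hypothesis disLR : [disjoint L & R].
Local Notation H := (biautomorphisms Gam).
Local Notation n := #|Gam|.

(** The first component is tested on [L] and the second on [R] because an edge from [x] in [L] to
    [y] in [R] is carried to an edge from [g.1 x] to [g.2 y]. *)
Definition side_preserved (g : {perm Gam} * {perm Gam}) : {set Gam} :=
  [set x | (x \in L) && (g.1 x \in L) || (x \in R) && (g.2 x \in R)].

Hypothesis n0 : (0 < n)%N.
Hypothesis HW : (45 * #|~: (L :|: R)| <= n)%N.
Hypothesis HA : forall g, g \in H ->
  (15 * #|side_preserved g| <= n)%N \/ (15 * #|~: side_preserved g| <= n)%N.

Definition side_sign (x : Gam) : int := (x \in L)%:Z - (x \in R)%:Z.

(** Both components enter, so that exchanging them leaves the value unchanged; the absolute value is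
    at most [2 * n]. *)
Definition corr (g : {perm Gam} * {perm Gam}) : int :=
  \sum_x side_sign x * (side_sign (g.1 x) + side_sign (g.2 x)).

Definition corr_sign (g : {perm Gam} * {perm Gam}) : int :=
  if 0 <= corr g then 1 else -1.

Lemma notLR x : (x \in L) && (x \in R) = false.
Proof. by apply/negP => /andP[xL xR]; rewrite (disjointFr disLR xL) in xR. Qed.

Lemma card_sumz (A : {set Gam}) : #|A|%:Z = \sum_x (x \in A)%:Z.
Proof.
rewrite -sum1_card big_mkcond /= (big_morph Posz PoszD (erefl _)).
by apply: eq_bigr => x _; case: (x \in A).
Qed.

(** For [A], [B] among [L], [R], [W] these are the entries of a 3 by 3 contingency table, whose
    margins are computed in [overlap_row] and [overlap_col]. *)
Definition overlap (A B : {set Gam}) (s : {perm Gam}) : int :=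
  \sum_x (x \in A)%:Z * (s x \in B)%:Z.

Lemma overlap_ge0 A B s : 0 <= overlap A B s.
Proof. by apply: sumr_ge0 => x _; case: (x \in A); case: (s x \in B). Qed.

Let W := ~: (L :|: R).

Lemma sides_partition x : (x \in L)%:Z + (x \in R)%:Z + (x \in W)%:Z = 1.
Proof.
rewrite !inE; have := notLR x.
by case: (x \in L); case: (x \in R).
Qed.

Lemma overlap_row A s :
  overlap A L s + overlap A R s + overlap A W s = #|A|%:Z.
Proof.
rewrite card_sumz -!big_split /=; apply: eq_bigr => x _.
by rewrite -!mulrDr sides_partition mulr1.
Qed.

Lemma overlap_col A s :
  overlap L A s + overlap R A s + overlap W A s = #|A|%:Z.
Proof.
rewrite card_sumz (reindex_perm s) -!big_split /=; apply: eq_bigr => x _.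
by rewrite -!mulrDl sides_partition mul1r.
Qed.

Lemma card_side_preserved g :
  #|side_preserved g|%:Z = overlap L L g.1 + overlap R R g.2.
Proof.
rewrite card_sumz -big_split /=; apply: eq_bigr => x _; rewrite inE.
have := notLR x.
by case: (x \in L); case: (x \in R); case: (_ \in L); case: (_ \in R).
Qed.

Lemma corrE g :
  corr g = overlap L L g.1 + overlap R R g.1 - overlap L R g.1 - overlap R L g.1
         + (overlap L L g.2 + overlap R R g.2 - overlap L R g.2 - overlap R L g.2).
Proof.
rewrite -!sumrN -!big_split /= ; apply: eq_bigr => x _; rewrite /side_sign; ring.
Qed.

Lemma card_sides : #|L|%:Z + #|R|%:Z + #|W|%:Z = n%:Z.
Proof.
rewrite !card_sumz -!big_split -cardsT card_sumz; apply: eq_bigr => x _ /=.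
by rewrite sides_partition inE.
Qed.

Lemma corr_sign_cases g : corr_sign g = 1 \/ corr_sign g = -1.
Proof. by rewrite /corr_sign; case: ifP; [left | right]. Qed.

(** Subtracting the column of [L] from the row of [R] cancels [overlap R L s] and leaves the error
    [overlap W L s - overlap R W s], a difference of two numbers between 0 and [#|W|]. *)
Lemma overlap_diff s :
  `|(overlap R R s - overlap L L s) - (#|R|%:Z - #|L|%:Z)| <= #|W|%:Z.
Proof.
have := (overlap_row R s, overlap_col L s) => -[hR hL].
have := (overlap_row W s, overlap_col W s) => -[hW hW'].
have [a1 a2 a3] := And3 (overlap_ge0 W L s) (overlap_ge0 W R s) (overlap_ge0 W W s).
have [b1 b2] := conj (overlap_ge0 L W s) (overlap_ge0 R W s).
lia.
Qed.

Lemma overlap_total s :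
  n%:Z - 2 * #|W|%:Z
    <= overlap L L s + overlap R R s + (overlap L R s + overlap R L s) <= n%:Z.
Proof.
have := (overlap_row L s, overlap_row R s) => -[hL hR].
have hW := overlap_col W s; have hn := card_sides.
have [a b c] := And3 (overlap_ge0 L W s) (overlap_ge0 R W s) (overlap_ge0 W W s).
lia.
Qed.

(* The sizes of the pieces of L, R and the rest under phi (s) and psi (t):
   14/9 is 2 - 4/15 - 8/45. *)
Lemma table_dichotomy (l r w N LLs LRs RLs RRs LLt LRt RLt RRt : int) :
  let c := LLs + RRs - LRs - RLs + (LLt + RRt - LRt - RLt) in
  0 <= N ->
  `|(RRs - LLs) - (r - l)| <= w -> `|(RRt - LLt) - (r - l)| <= w ->
  N - 2 * w <= LLs + RRs + (LRs + RLs) <= N ->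
  N - 2 * w <= LLt + RRt + (LRt + RLt) <= N ->
  15 * (LLs + RRt) <= N \/ 15 * (N - (LLs + RRt)) <= N ->
  45 * w <= N ->
  14 * N <= 9 * ((if 0 <= c then 1 else -1) * c).
Proof.
move=> c N0; rewrite !ler_norml => /andP[? ?] /andP[? ?] /andP[? ?] /andP[? ?] hA hw.
by rewrite /c; case: (lerP 0 _) => hc; case: hA => hA; lra.
Qed.

(** The size of [side_preserved] controls only [g.1] on [L] and [g.2] on [R]; [overlap_diff]
    transfers this to [g.1] on [R] and [g.2] on [L]. *)
Lemma corr_large (g : {perm Gam} * {perm Gam}) : g \in H -> 14 * n%:Z <= 9 * (corr_sign g * corr g).
Proof.
move=> gH.
have hA : (15 * #|side_preserved g|%:Z <= n%:Z) \/
          (15 * (n%:Z - #|side_preserved g|%:Z) <= n%:Z).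
  by have := cardsC (side_preserved g); case: (HA gH) => ? ?; [left | right]; lia.
have hW : 45 * #|W|%:Z <= n%:Z by move: HW; rewrite -/W; lia.
move: hA hW; rewrite card_side_preserved /corr_sign corrE.
have := (overlap_diff g.1, overlap_diff g.2) => -[d1 d2].
have := (overlap_total g.1, overlap_total g.2) => -[t1 t2] hA hW.
exact: (table_dichotomy _ d1 d2 t1 t2 hA hW).
Qed.

(** If all three values are signs, put p and q for the first two terms: the left side is p + q - pq
    = 1 - (1 - p)(1 - q). *)
Lemma side_sign_triple x y z (a b : int) :
  a = 1 \/ a = -1 -> b = 1 \/ b = -1 ->
  a * (side_sign x * side_sign y) + b * (side_sign y * side_sign z)
   - a * b * (side_sign x * side_sign z) <= 1.
Proof.
move=> ha hb.
rewrite /side_sign; have := (notLR x, notLR y, notLR z).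
case: ha => ->; case: hb => ->; case: (x \in L); case: (x \in R) => //;
case: (y \in L); case: (y \in R); case: (z \in L); case: (z \in R);
by move=> [[? ?] ?].
Qed.

(** If multiplicativity failed, the three terms of the summed triple inequality would each be at
    least 14n/9, with total 14n/3, above the bound 2n. *)
Lemma corr_signM (g h : {perm Gam} * {perm Gam}) : g \in H -> h \in H -> (g * h)%g \in H ->
  corr_sign (g * h)%g = corr_sign g * corr_sign h.
Proof.
move=> gH hH ghH.
have [cg ch cgh] := And3 (corr_large gH) (corr_large hH) (corr_large ghH).
(* Reindexing by [g] places the correlation of [h] on the second leg of the path from [x] through
   [g] to [g * h]. *)
have hE : corr h = \sum_x side_sign (g.1 x) * side_sign (h.1 (g.1 x))
                 + \sum_x side_sign (g.2 x) * side_sign (h.2 (g.2 x)).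
  rewrite /corr; under eq_bigr do rewrite mulrDr.
  by rewrite big_split (reindex_perm g.1) [X in _ + X = _](reindex_perm g.2).
have : corr_sign g * corr g + corr_sign h * corr h
        - corr_sign g * corr_sign h * corr (g * h)%g <= 2 * n%:Z.
  have nE : 2 * n%:Z = \sum_(x : Gam) 2.
    by rewrite sumr_const -[RHS]mulr_natr (natz n).
  rewrite hE nE -big_split /= /corr !mulr_sumr -sumrN -!big_split /=.
  apply: ler_sum => x _; rewrite !permM.
  have h1 := side_sign_triple x (g.1 x) (h.1 (g.1 x)) (corr_sign_cases g) (corr_sign_cases h).
  have h2 := side_sign_triple x (g.2 x) (h.2 (g.2 x)) (corr_sign_cases g) (corr_sign_cases h).
  apply: le_trans (lerD h1 h2) => //; rewrite le_eqVlt; apply/orP; left; apply/eqP; ring.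
move: cg ch cgh n0.
case: (corr_sign_cases g) => ->; case: (corr_sign_cases h) => ->;
  case: (corr_sign_cases (g * h)%g) => -> //; clear; lia.
Qed.

Lemma biaut_mul (g h : {perm Gam} * {perm Gam}) : g \in H -> h \in H -> (g * h)%g \in H.
Proof.
by move=> /biautP hg /biautP hh; apply/biautP => x y; rewrite !permM hh hg.
Qed.

Definition swap_pair (g : {perm Gam} * {perm Gam}) := (g.2, g.1).

Lemma swap_pairK : involutive swap_pair.
Proof. by case. Qed.

Lemma biaut_swap g : (swap_pair g \in H) = (g \in H).
Proof.
suff imp h : h \in H -> swap_pair h \in H.
  by apply/idP/idP => /imp //; rewrite swap_pairK.
by move=> /biautP hh; apply/biautP => x y; rewrite Hund hh Hund.
Qed.

Lemma corr_sign_swap g : corr_sign (swap_pair g) = corr_sign g.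
Proof.
rewrite /corr_sign; suff -> : corr (swap_pair g) = corr g by [].
by apply: eq_bigr => x _; rewrite addrC.
Qed.

Definition twisted_average (x : Gam) : int :=
  \sum_(g in H) corr_sign g * side_sign (g.1 x).
Local Notation F := twisted_average.

Lemma biaut_mull (k g : {perm Gam} * {perm Gam}) : k \in H -> ((k * g)%g \in H) = (g \in H).
Proof.
move=> kH; apply/idP/idP => [|gH]; last exact: biaut_mul.
have /biautP hk := kH.
move=> /biautP hkg; apply/biautP => x y.
have := hkg ((k.1)^-1 x)%g ((k.2)^-1 y)%g; rewrite !permM !permKV => ->.
by rewrite -hk !permKV.
Qed.

Lemma twisted_average1 (k : {perm Gam} * {perm Gam}) x :
  k \in H -> F (k.1 x) = corr_sign k * F x.
Proof.
move=> kH; rewrite mulr_sumr [RHS](reindex_inj (mulgI k)).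
apply: eq_big => g; first by rewrite biaut_mull.
move=> gH; rewrite permM corr_signM ?biaut_mul // !mulrA.
by case: (corr_sign_cases k) => ->; rewrite ?mul1r ?mulN1r ?opprK.
Qed.

(** The second component of [k] is the first component of [swap_pair k], which lies in [H] and has
    the same sign. *)
Lemma twisted_average2 (k : {perm Gam} * {perm Gam}) x :
  k \in H -> F (k.2 x) = corr_sign k * F x.
Proof.
move=> kH; rewrite -corr_sign_swap -twisted_average1 //.
by rewrite biaut_swap.
Qed.

Lemma norm_twisted_average x : side_sign x * F x <= #|H|%:Z.
Proof.
rewrite mulr_sumr -sum1_card (big_morph Posz PoszD (erefl _)).
apply: ler_sum => g _; rewrite /side_sign; have := (notLR x, notLR (g.1 x)).
case: (corr_sign_cases g) => ->; case: (x \in L); case: (x \in R);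
  by case: (_ \in L); case: (_ \in R) => -[].
Qed.

Lemma sum_twisted_average :
  14 * n%:Z * #|H|%:Z <= 18 * \sum_x side_sign x * F x.
Proof.
have E1 : \sum_x side_sign x * F x
    = \sum_(g in H) corr_sign g * \sum_x side_sign x * side_sign (g.1 x).
  under eq_bigr do rewrite mulr_sumr; rewrite exchange_big; apply: eq_bigr => g _.
  by rewrite mulr_sumr; apply: eq_bigr => x _; rewrite mulrCA.
(* The average is built from first components only; the swap gives the same sum with second
   components. Adding both produces [corr], hence 18 = 2 * 9. *)
have E2 : \sum_x side_sign x * F x
    = \sum_(g in H) corr_sign g * \sum_x side_sign x * side_sign (g.2 x).
  rewrite E1 (reindex_inj (inv_inj swap_pairK)).
  by apply: eq_big => g; [exact: biaut_swap | rewrite corr_sign_swap].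
have -> : 18 * \sum_x side_sign x * F x = \sum_(g in H) 9 * (corr_sign g * corr g).
  have -> : \sum_(g in H) 9 * (corr_sign g * corr g)
      = 9 * (\sum_x side_sign x * F x + \sum_x side_sign x * F x); last by ring.
    rewrite {1}E1 E2 -big_split -mulr_sumr; congr (9 * _); apply: eq_bigr => g _ /=.
    rewrite -mulrDr -big_split; congr (_ * _); apply: eq_bigr => x _.
    by rewrite mulrDr.
have -> : 14 * n%:Z * #|H|%:Z = \sum_(g in H) 14 * n%:Z.
  by rewrite sumr_const -[RHS]mulr_natr (natz #|H|).
by apply: ler_sum => g gH; exact: corr_large.
Qed.

Lemma biaut1 : (1%g : {perm Gam} * {perm Gam}) \in H.
Proof. by apply/biautP => x y; rewrite !perm1. Qed.

Definition positive_side : {set Gam} := [set x | 0 < F x].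

Definition compatible : {set Gam} :=
  [set x | (x \in L) && (x \in positive_side)
        || (x \in R) && (x \notin positive_side)].

Definition agreement : {set Gam} := [set x | 0 < side_sign x * F x].

(** A sum of at least (7/9) n [#|H|], with each term at most [#|H|], has at least 7n/9 positive
    terms. *)
Lemma card_agreement : (7 * n <= 9 * #|agreement|)%N.
Proof.
have H0 : (0 < #|H|)%N by apply/card_gt0P; exists 1%g; exact: biaut1.
have : \sum_x side_sign x * F x <= #|agreement|%:Z * #|H|%:Z.
  rewrite card_sumz mulr_suml; apply: ler_sum => x _; rewrite inE.
  by case: (ltrP 0) => h; rewrite ?mul1r ?mul0r //; exact: norm_twisted_average.
have := sum_twisted_average.
set k := #|agreement|; set S := \sum_x _ => h1 h2.
rewrite -lez_nat -(ler_pM2r (x := #|H|%:Z)) //; lia.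
Qed.

(** One vertex of [agreement] has nonzero average; transitivity and equivariance spread this to all
    vertices. *)
Lemma twisted_average_neq0 x : F x != 0.
Proof.
have : (0 < #|agreement|)%N.
  by have := card_agreement; lia.
case/card_gt0P => y; rewrite inE => hy.
have [g gH <-] := Htr y x; rewrite twisted_average1 //.
have : F y != 0 by apply: contraTneq hy => ->; rewrite mulr0.
by case: (corr_sign_cases g) => ->; rewrite ?mul1r // mulN1r oppr_eq0.
Qed.

Lemma card_compatible : (9 * #|~: compatible| <= 2 * n)%N.
Proof.
have : (#|agreement| <= #|compatible|)%N.
  apply: subset_leq_card; apply/subsetP => x; rewrite !inE /side_sign.
  have := notLR x; case: (x \in L); case: (x \in R) => //= _.
  - by rewrite subr0 mul1r => ->.
  - by rewrite sub0r mulN1r oppr_gt0 => /ltW; rewrite leNgt.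
  - by rewrite subrr mul0r ltxx.
by have := cardsC compatible; have := card_agreement; lia.
Qed.

Definition same_side (O : {set Gam}) (x : Gam) : pred Gam :=
  fun y => (x \in O) == (y \in O).

(** Both components multiply [F] by the same sign, so they both keep or both exchange the sides; the
    exchange uses that [F] has no zero. *)
Lemma same_side_biaut g x y :
  g \in H ->
  same_side positive_side (g.1 x) (g.2 y) = same_side positive_side x y.
Proof.
move=> gH; rewrite /same_side !inE twisted_average1 // twisted_average2 //.
case: (corr_sign_cases g) => ->; rewrite ?mul1r ?mulN1r ?oppr_gt0 //.
have neg z : (F z < 0) = ~~ (0 < F z).
  by rewrite -leNgt le_eqVlt (negPf (twisted_average_neq0 z)).
by rewrite !neg; case: (0 < F x); case: (0 < F y).
Qed.

Lemma same_side_regular :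
  exists c, forall x, (\sum_(y | same_side positive_side x y) mult x y = c)%N.
Proof.
have /card_gt0P [x0 _] := n0.
exists (\sum_(y | same_side positive_side x0 y) mult x0 y)%N => x.
have [g gH <-] := Htr x0 x; rewrite (reindex_perm g.2) /=.
apply: eq_big => y; first exact: same_side_biaut.
by move=> _; move/biautP: gH.
Qed.

End SignCharacter.

(** The constants 45 and 15 are those of the vertex case; the edge case supplies 90 and 45. *)
Lemma almost_invariant_sides (Gam : mgraph) (L R : {set Gam}) :
  undirected Gam -> bitransitive Gam -> [disjoint L & R] -> (0 < #|Gam|)%N ->
  (45 * #|~: (L :|: R)| <= #|Gam|)%N ->
  (forall g, g \in biautomorphisms Gam ->
     (15 * #|side_preserved L R g| <= #|Gam|)%N \/
     (15 * #|~: side_preserved L R g| <= #|Gam|)%N) ->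
  exists O : {set Gam}, exists c : nat,
    (forall x, (\sum_(y | same_side O x y) mult x y = c)%N) /\
    (9 * #|~: ((L :&: O) :|: (R :\: O))| <= 2 * #|Gam|)%N.
Proof.
move=> Hund Htr disLR n0 HW HA; exists (positive_side L R).
have [c Hc] := same_side_regular Hund Htr disLR n0 HW HA; exists c; split=> //.
have := card_compatible Hund disLR n0 HW HA.
suff -> : compatible L R = L :&: positive_side L R :|: R :\: positive_side L R by [].
by apply/setP => x; rewrite !inE andbC [in RHS]andbC; congr orb; rewrite andbC.
Qed.

(** * Counting edges that stay on one side *)

Section Counting.
Variables (Gam : mgraph) (L R O : {set Gam}) (c : nat).
Hypothesis Hund : undirected Gam.
Hypothesis Hc : forall x, (\sum_(y | same_side O x y) mult x y = c)%N.
Local Notation n := #|Gam|.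
Let C : {set Gam} := (L :&: O) :|: (R :\: O).

Lemma same_side_degree_gt0 : ~ bipartite Gam -> (0 < c)%N.
Proof.
move=> Hnb; rewrite lt0n; apply/eqP => c0; apply: Hnb; exists O => x y /eqP xy.
by have /eqP := Hc x; rewrite c0 sum_nat_eq0 => /forallP /(_ y) /implyP /(_ xy) /eqP.
Qed.

(** Same-side pairs with first vertex outside [C] contribute [c * #|~: C|], and by symmetry those
    with second vertex outside [C] at most as much. *)
Lemma same_side_count :
  (c * n <= 2 * (c * #|~: C|)
     + \sum_(x in C) \sum_(y in C | same_side O x y) mult x y)%N.
Proof.
have -> : (c * n = \sum_x \sum_(y | same_side O x y) mult x y)%N.
  by rewrite (eq_bigr (fun => c)) // sum_nat_const mulnC.
have cC : (\sum_(x in ~: C) \sum_(y | same_side O x y) mult x y = c * #|~: C|)%N.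
  by rewrite (eq_bigr (fun => c)) // sum_nat_const mulnC.
have cC' : (\sum_(x in C) \sum_(y in ~: C | same_side O x y) mult x y <= c * #|~: C|)%N.
  rewrite -cC (exchange_big_dep (mem (~: C))) /=; last by move=> x y _ /andP[].
  apply: leq_sum => y _; rewrite big_mkcond [leqRHS]big_mkcond /=.
  apply: leq_sum => x _; rewrite Hund /same_side eq_sym.
  by case: eqP => _; rewrite ?andbF //; case: ifP.
have CE : (\sum_(x in C) \sum_(y | same_side O x y) mult x y
    = \sum_(x in C) \sum_(y in C | same_side O x y) mult x y
    + \sum_(x in C) \sum_(y in ~: C | same_side O x y) mult x y)%N.
  rewrite -big_split; apply: eq_bigr => x _; rewrite (bigID (mem C)) /=.
  by congr addn; apply: eq_bigl => y; rewrite ?in_setC andbC.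
rewrite (bigID (mem C)) /= CE.
have -> : (\sum_(x | x \notin C) \sum_(y | same_side O x y) mult x y = c * #|~: C|)%N.
  by rewrite -cC; apply: eq_bigl => x; rewrite in_setC.
lia.
Qed.

End Counting.

(** * Boundaries and Cheeger constants *)

Section Boundary.
Variable Gam : mgraph.
Hypothesis Hund : undirected Gam.
Local Notation n := #|Gam|.
Implicit Types A B L R S : {set Gam}.

Lemma edge_countC A B : edge_count A B = edge_count B A.
Proof.
rewrite /edge_count exchange_big; apply: eq_bigr => x _; apply: eq_bigr => y _.
exact: Hund.
Qed.

Lemma edge_boundaryC S : edge_boundary_size (~: S) = edge_boundary_size S.
Proof. by rewrite /edge_boundary_size setCK edge_countC. Qed.

Lemma nbhdP A v : reflect (exists2 u, u \in A & (0 < mult u v)%N) (v \in nbhd A).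
Proof. by rewrite inE; apply: (iffP existsP) => [[u /andP[]]|[u]] *; exists u => //; apply/andP. Qed.

Lemma cheeger_set_half S : S != set0 -> (2 * #|S| <= n)%N -> cheeger_set S.
Proof. by move=> S0 S2; rewrite /cheeger_set S0. Qed.

Lemma edge_cheeger_le d S : (0 < d)%N -> (2 * #|S| <= n)%N ->
  edge_cheeger Gam d * (d * #|S|)%:R <= (edge_boundary_size S)%:R.
Proof.
move=> d0 S2; have [->|S0] := eqVneq S set0; first by rewrite cards0 muln0 mulr0 ler0n.
rewrite -ler_pdivlMr; first exact/min_over_le/cheeger_set_half.
by rewrite ltr0n muln_gt0 d0 card_gt0.
Qed.

Lemma vert_cheeger_le S : (2 * #|S| <= n)%N ->
  vert_cheeger Gam * #|S|%:R <= #|vert_boundary S|%:R.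
Proof.
move=> S2; have [->|S0] := eqVneq S set0; first by rewrite cards0 mulr0 ler0n.
rewrite -ler_pdivlMr; first exact/min_over_le/cheeger_set_half.
by rewrite ltr0n card_gt0.
Qed.

Lemma min_over_ge0 (T : finType) (P : pred T) (F : T -> rat) :
  (forall x, P x -> 0 <= F x) -> 0 <= min_over P F.
Proof.
move=> F0; rewrite /min_over; case: pickP => [x0 Px0|//].
by case: arg_minP => // i Pi _; exact: F0.
Qed.

Lemma min_over_le_bound (T : finType) (P : pred T) (F : T -> rat) (x : rat) :
  0 <= x -> (forall y, P y -> exists2 z, P z & F z <= x) -> min_over P F <= x.
Proof.
move=> x0 H; case: (pickP P) => [y /H [z Pz Fz]|P0].
  exact: le_trans (min_over_le _ Pz) Fz.
by rewrite /min_over; case: pickP => [y|//]; rewrite P0.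
Qed.

Lemma edge_cheeger_le1 d : regular Gam d -> edge_cheeger Gam d <= 1.
Proof.
move=> Hreg; apply: min_over_le_bound => // S HS; exists S => //.
have le : (edge_boundary_size S <= d * #|S|)%N.
  rewrite mulnC -sum_nat_const; apply: leq_sum => x _.
  by rewrite -(Hreg x) [leqRHS](bigID (mem (~: S))) leq_addr.
(* For [d = 0] the quotient is 0 by the convention on division. *)
have [z|z] := posnP (d * #|S|); first by rewrite z invr0 mulr0.
by rewrite ler_pdivrMr ?ltr0n // mul1r ler_nat.
Qed.

(* A largest admissible set S has #|~: S| <= 2 * #|S|. *)
Lemma vert_cheeger_le2 : vert_cheeger Gam <= 2.
Proof.
apply: min_over_le_bound => // S /andP[S0 S2].
have hn := odd_double_half n.
have hs : size (take n./2 (enum Gam)) = n./2.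
  by rewrite size_takel // -cardE -divn2 leq_div.
pose U := [set x in take n./2 (enum Gam)].
have U2 : #|U| = n./2.
  by rewrite cardsE (card_uniqP _) // take_uniq // enum_uniq.
have S1 : (0 < #|S|)%N by rewrite card_gt0.
exists U; first by rewrite /cheeger_set -card_gt0 U2; apply/andP; split; lia.
rewrite ler_pdivrMr ?ltr0n; last by lia.
rewrite -natrM ler_nat.
have : (#|vert_boundary U| <= #|~: U|)%N.
  by apply: subset_leq_card; apply/subsetP => x; rewrite !inE => /andP[].
by have := cardsC U; lia.
Qed.

Lemma vert_boundary_interior S :
  vert_boundary (~: (S :|: vert_boundary S)) \subset vert_boundary S.
Proof.
apply/subsetP => y; rewrite !inE negbK => /andP[yS /existsP[x /andP[]]].
rewrite !inE negb_or => /andP[xS]; rewrite xS /= => xN xy.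
case/orP: yS => // yS; case/negP: xN; apply/existsP; exists y.
by rewrite yS Hund.
Qed.

(** The vertex boundary is not symmetric under complement. For large [S], expansion is applied
    instead to [~: S] with the boundary of [S] removed, whose own boundary lies in that of [S]. *)
Lemma vert_dichotomy S :
  vert_cheeger Gam * #|S|%:R <= #|vert_boundary S|%:R \/
  vert_cheeger Gam * (#|~: S|%:R - #|vert_boundary S|%:R) <= #|vert_boundary S|%:R.
Proof.
have [S2|S2] := leqP (2 * #|S|) n; first by left; exact: vert_cheeger_le.
right; set U := ~: (S :|: vert_boundary S).
have UE : (#|~: S| = #|U| + #|vert_boundary S|)%N.
  rewrite -(cardsID (vert_boundary S) (~: S)) addnC; congr (_ + _)%N; apply: eq_card => x;
  by rewrite !inE; case: (x \in S) => //=; rewrite andbC.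
have U2 : (2 * #|U| <= n)%N by have := cardsC S; lia.
rewrite UE natrD addrK; apply: le_trans (vert_cheeger_le U2) _.
by rewrite ler_nat subset_leq_card // vert_boundary_interior.
Qed.

End Boundary.

(** * The edge bound *)

Section EdgeBound.
Variables (Gam : mgraph) (d : nat) (L R : {set Gam}).
Hypotheses (Hund : undirected Gam) (Hreg : regular Gam d).
Hypotheses (Hnb : ~ bipartite Gam) (Htr : bitransitive Gam).
Hypotheses (disLR : [disjoint L & R]) (LR0 : L :|: R != set0).
Local Notation n := #|Gam|.
Local Notation h := (edge_cheeger Gam d).
Let b := (edge_count L (~: R) + edge_count R (~: L))%N.

Lemma edge_countE (A B : {set Gam}) :
  edge_count A B = (\sum_x \sum_y ((x \in A) && (y \in B)) * mult x y)%N.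
Proof.
rewrite /edge_count big_mkcond; apply: eq_bigr => x _; case: (x \in A).
  by rewrite big_mkcond; apply: eq_bigr => y _; case: (y \in B); rewrite ?mul1n.
by rewrite big1.
Qed.

Lemma edge_boundary_union : (edge_boundary_size (L :|: R) <= b)%N.
Proof.
rewrite /b /edge_boundary_size !edge_countE -big_split /=; apply: leq_sum => x _.
rewrite -big_split /=; apply: leq_sum => y _; rewrite !inE -mulnDl leq_mul2r.
by apply/orP; right; case: (x \in L); case: (x \in R); case: (y \in L); case: (y \in R).
Qed.

(** If an edge leaves the set, then it or its image under [g] is counted by [b]; [g] permutes the
    edges, so each alternative costs at most [b]. *)
Lemma edge_boundary_side_preserved g : g \in biautomorphisms Gam ->
  (edge_boundary_size (side_preserved L R g) <= 2 * b)%N.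
Proof.
move=> /biautP hg; rewrite mul2n -addnn {2}/b.
have -> : edge_count L (~: R) = (\sum_x \sum_y
    ((g.1 x \in L) && (g.2 y \in ~: R)) * mult x y)%N.
  rewrite edge_countE (reindex_perm g.1); apply: eq_bigr => x _.
  by rewrite (reindex_perm g.2); apply: eq_bigr => y _; rewrite hg.
(* Edges from [R] are transported by the swapped pair, which preserves [mult] by symmetry. *)
have -> : edge_count R (~: L) = (\sum_x \sum_y
    ((g.2 x \in R) && (g.1 y \in ~: L)) * mult x y)%N.
  rewrite edge_countE (reindex_perm g.2); apply: eq_bigr => x _.
  rewrite (reindex_perm g.1); apply: eq_bigr => y _.
  by rewrite Hund hg Hund.
rewrite /b /edge_boundary_size !edge_countE -!big_split /=; apply: leq_sum => x _.
rewrite -!big_split /=; apply: leq_sum => y _; rewrite !inE -!mulnDl leq_mul2r.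
apply/orP; right.
by case: (x \in L); case: (x \in R); case: (g.1 x \in L); case: (g.2 x \in R);
   case: (y \in L); case: (y \in R); case: (g.1 y \in L); case: (g.2 y \in R).
Qed.

(** Expansion is applied to whichever of [S] and [~: S] is at most half; [hb] forces [h > 0], so [h]
    cancels, and the factor [d] is dropped. *)
Lemma edge_dichotomy (S : {set Gam}) k : (90%:R * b%:R < h * n%:R) -> (0 < d)%N ->
  (edge_boundary_size S <= k * b)%N -> (90 * #|S| <= k * n)%N \/ (90 * #|~: S| <= k * n)%N.
Proof.
move=> hb d0 hS.
have h0 : 0 < h.
  rewrite ltNge; apply/negP => hle.
  have : h * n%:R <= 0 by rewrite mulr_le0_ge0.
  by move/(lt_le_trans hb); rewrite -natrM ltrn0.
have main (T : {set Gam}) : (2 * #|T| <= n)%N -> (edge_boundary_size T <= k * b)%N ->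
    (90 * #|T| <= k * n)%N.
  move=> T2 hT; have := edge_cheeger_le d0 T2.
  move: hT; rewrite -(ler_nat rat) => hT /le_trans /(_ hT) le.
  have : h * (90 * (d * #|T|))%:R <= h * (k * n)%:R.
    rewrite [in leLHS]natrM mulrCA; apply: le_trans (ler_wpM2l (ler0n rat 90) le) _.
    rewrite (natrM _ k b) (natrM _ k n) mulrCA [leRHS]mulrCA.
    by apply: ler_wpM2l; [exact: ler0n | exact: ltW].
  rewrite (ler_pM2l h0) ler_nat; apply: leq_trans.
  exact: leq_mul (leqnn 90) (leq_pmull _ d0).
have [S2|S2] := leqP (2 * #|S|) n; [left; exact: main | right].
apply: main; last by rewrite edge_boundaryC.
by have := cardsC S; lia.
Qed.

(** Two vertices of this set on the same side of [O] are both in [L] or both in [R], so an edge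
    between them is counted by [b]. *)
Lemma same_side_edges_le (O : {set Gam}) :
  (\sum_(x in L :&: O :|: R :\: O)
     \sum_(y in L :&: O :|: R :\: O | same_side O x y) mult x y <= b)%N.
Proof.
rewrite /b !edge_countE -big_split big_mkcond /=; apply: leq_sum => x _.
rewrite -big_split; case: ifP => // xC.
rewrite big_mkcond /=; apply: leq_sum => y _; rewrite -mulnDl /same_side.
case: ifP => // /andP[yC]; move: xC yC.
rewrite !inE => xC yC xy; rewrite leq_pmull //.
move: xC yC xy (notLR disLR x) (notLR disLR y).
by case: (x \in O); case: (y \in O); case: (x \in L); case: (x \in R);
   case: (y \in L); case: (y \in R).
Qed.

Lemma degree_gt0 : (0 < d)%N.
Proof.
rewrite lt0n; apply/eqP => d0; apply: Hnb; exists set0 => x y _.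
by have /eqP := Hreg x; rewrite d0 sum_nat_eq0 => /forallP /(_ y) /eqP.
Qed.

Lemma edge_bound : h * #|L :|: R|%:R <= 90%:R * b%:R.
Proof.
rewrite leNgt; apply/negP => hlt.
have d0 := degree_gt0.
have [x0 x0D] := set0Pn _ LR0.
have n0 : (0 < n)%N by apply/card_gt0P; exists x0.
have h1 : h <= 1 := edge_cheeger_le1 Hreg.
have h0 : 0 <= h.
  by apply: min_over_ge0 => S _; rewrite divr_ge0 ?ler0n.
have hn : 90%:R * b%:R < h * n%:R.
  by apply: lt_le_trans hlt (ler_wpM2l h0 _); rewrite ler_nat max_card.
have bn : (90 * b < n)%N.
  rewrite -(ltr_nat rat) natrM; apply: lt_le_trans hn _.
  by rewrite -[leRHS]mul1r; apply: ler_wpM2r h1; exact: ler0n.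
(* Otherwise expansion of [L :|: R] itself would contradict [hlt]. *)
have HD : (2 * #|~: (L :|: R)| <= n)%N.
  rewrite leqNgt; apply/negP => W2.
  have D2 : (2 * #|L :|: R| <= n)%N by have := cardsC (L :|: R); lia.
  have hD : h * #|L :|: R|%:R <= b%:R.
    apply: le_trans (le_trans (edge_cheeger_le d0 D2) _); last first.
      by rewrite ler_nat edge_boundary_union.
    by apply: ler_wpM2l h0 _ _ _; rewrite ler_nat leq_pmull.
  move: (lt_le_trans hlt hD); rewrite -natrM ltr_nat; lia.
have HW : (45 * #|~: (L :|: R)| <= n)%N.
  have eb : (edge_boundary_size (~: (L :|: R)) <= 1 * b)%N.
    rewrite mul1n (edge_boundaryC Hund); exact: edge_boundary_union.
  have [|] := edge_dichotomy hn d0 eb; first by lia.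
  by rewrite setCK; have := cardsC (L :|: R); lia.
have HA g : g \in biautomorphisms Gam ->
    (15 * #|side_preserved L R g| <= n)%N \/ (15 * #|~: side_preserved L R g| <= n)%N.
  move=> gH; have [|] := edge_dichotomy hn d0 (edge_boundary_side_preserved gH).
    by left; lia.
  by right; lia.
have [O [c [Hc HC]]] := almost_invariant_sides Hund Htr disLR n0 HW HA.
have c0 := same_side_degree_gt0 Hc Hnb.
have := same_side_count L R Hund Hc.
have := same_side_edges_le O.
set k := #|_| in HC *; move: (\sum_(x in _) _)%N => E le1 le2.
(* Now cn <= 4cn/9 + b with b < n/90. Only c >= 1 is known, so b is compared with n and not with dn;
   hence the [d] in the final denominator. *)
have : (c * (9 * k) <= c * (2 * n))%N by rewrite leq_mul2l HC orbT.
have : (n <= c * n)%N by rewrite leq_pmull.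
by move: le2; rewrite !(mulnCA c); move: (c * n)%N (c * k)%N; lia.
Qed.

End EdgeBound.

(** * The vertex bound *)

Lemma expansion_size (c h x k b n : rat) : 0 <= c -> 0 <= k -> 0 < h ->
  c * b <= h * n -> h * x <= k * b -> c * x <= k * n.
Proof.
move=> c0 k0 h0 hb hx; rewrite -(ler_pM2l h0) mulrCA.
apply: le_trans (ler_wpM2l c0 hx) _; rewrite mulrCA [leRHS]mulrCA.
exact: ler_wpM2l k0 _ _ hb.
Qed.

(** Here hs <= v + hv, and h <= 2 gives the factor 3 = 1 + 2 lost when passing to the complement. *)
Lemma interior_size (h v s t : rat) :
  0 <= h -> h <= 2 -> v <= t -> h * (s - v) <= v -> 0 <= t -> h * s <= 3 * t.
Proof.
move=> h0 h2 vt hs t0.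
have : h * v <= h * t by exact: ler_wpM2l.
have : h * t <= 2 * t by exact: ler_wpM2r.
by move: hs; rewrite mulrBr; lra.
Qed.

Section VertBound.
Variables (Gam : mgraph) (L R : {set Gam}).
Hypotheses (Hund : undirected Gam).
Hypotheses (Hnb : ~ bipartite Gam) (Htr : bitransitive Gam).
Hypotheses (disLR : [disjoint L & R]) (LR0 : L :|: R != set0).
Local Notation n := #|Gam|.
Local Notation h := (vert_cheeger Gam).
(** The exceptional vertices: outside [T], every neighbour of [L] is in [R] and every neighbour of
    [R] is in [L]. *)
Let T : {set Gam} := (L :&: nbhd L) :|: (R :&: nbhd R) :|: vert_boundary (L :|: R).
Let b := (#|L :&: nbhd L| + #|R :&: nbhd R| + #|vert_boundary (L :|: R)|)%N.

Lemma card_exceptional : (#|T| <= b)%N.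
Proof.
by rewrite /T /b; apply: leq_trans (leq_card_setU _ _) _; rewrite leq_add2r leq_card_setU.
Qed.

Lemma nbhd_mem (A : {set Gam}) u v : u \in A -> (0 < mult u v)%N -> v \in nbhd A.
Proof. by move=> uA uv; apply/nbhdP; exists u. Qed.

Lemma neighbour_of_left u v : u \in L -> (0 < mult u v)%N -> v \notin T -> v \in R.
Proof.
move=> uL uv; apply: contraR => vR; rewrite 2!in_setU.
have [vL|vL] := boolP (v \in L); first by rewrite in_setI vL (nbhd_mem uL uv).
apply/orP; right; rewrite in_setD in_setU (negPf vL) (negPf vR) /=.
by apply: (nbhd_mem (u := u)) uv; rewrite in_setU uL.
Qed.

Lemma neighbour_of_right u v : u \in R -> (0 < mult u v)%N -> v \notin T -> v \in L.
Proof.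
move=> uR uv; apply: contraR => vL; rewrite 2!in_setU.
have [vR|vR] := boolP (v \in R); first by rewrite !in_setI vR (nbhd_mem uR uv) orbT.
apply/orP; right; rewrite in_setD in_setU (negPf vL) (negPf vR) /=.
by apply: (nbhd_mem (u := u)) uv; rewrite in_setU uR orbT.
Qed.

(** If [y] has a neighbour in the set and none of [y], [g.1 y], [g.2 y] is exceptional, then [y] is
    in the set too. *)
Lemma vert_boundary_side_preserved g : g \in biautomorphisms Gam ->
  (#|vert_boundary (side_preserved L R g)| <= 3 * b)%N.
Proof.
move=> /biautP hg.
have sub : vert_boundary (side_preserved L R g)
    \subset T :|: g.1 @^-1: T :|: g.2 @^-1: T.
  apply/subsetP => y; rewrite in_setD => /andP[yA /nbhdP[x xA xy]].
  rewrite (in_setU y (T :|: _)) (in_setU y T) ![y \in _ @^-1: _]inE; apply: contraR yA.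
  rewrite !negb_or => /andP[/andP[yT y1] y2].
  have xy2 : (0 < mult (g.2 x) (g.1 y))%N by rewrite Hund hg Hund.
  have xy1 : (0 < mult (g.1 x) (g.2 y))%N by rewrite hg.
  move: xA; rewrite !inE => /orP[/andP[xL gxL]|/andP[xR gxR]].
    by rewrite (neighbour_of_left xL xy yT) (neighbour_of_left gxL xy1 y2) orbT.
  by rewrite (neighbour_of_right xR xy yT) (neighbour_of_right gxR xy2 y1).
have := subset_leq_card sub; have := card_exceptional.
have := (leq_card_setU (T :|: g.1 @^-1: T) (g.2 @^-1: T)).1.
have := (leq_card_setU T (g.1 @^-1: T)).1.
rewrite !card_preimset; [lia | exact: perm_inj | exact: perm_inj].
Qed.

Lemma vert_size_dichotomy (S : {set Gam}) k :
  135%:R * b%:R < h * n%:R ->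
  (#|vert_boundary S| <= k * b)%N ->
  (135 * #|S| <= k * n)%N \/ (135 * #|~: S| <= (k * 3) * n)%N.
Proof.
rewrite -(ler_nat rat) natrM; move: 135%N => m hb hS.
have h0 : 0 < h.
  rewrite ltNge; apply/negP => hle.
  have : h * n%:R <= 0 by rewrite mulr_le0_ge0.
  by move/(lt_le_trans hb); rewrite -natrM ltrn0.
have k0 : (0 : rat) <= k%:R by [].
have b0 : (0 : rat) <= b%:R by [].
case: (vert_dichotomy Hund S) => hx; [left | right].
  rewrite -(ler_nat rat) !natrM.
  exact: expansion_size (ler0n _ _) k0 h0 (ltW hb) (le_trans hx hS).
rewrite -(ler_nat rat) !natrM.
apply: (expansion_size (h := h) (b := b%:R)) (ltW hb) _ => //.
  by rewrite mulr_ge0.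
rewrite -mulrA mulrCA.
exact: interior_size (ltW h0) (vert_cheeger_le2 Gam) hS hx (mulr_ge0 k0 b0).
Qed.

(** A vertex of this set outside [T] has no neighbour in the set on its own side, and a vertex of
    [T] has at most [c]. *)
Lemma same_side_edges_le_vert (O : {set Gam}) c :
  (forall x, (\sum_(y | same_side O x y) mult x y = c)%N) ->
  (\sum_(x in L :&: O :|: R :\: O)
     \sum_(y in L :&: O :|: R :\: O | same_side O x y) mult x y <= c * b)%N.
Proof.
move=> Hc; apply: (@leq_trans (\sum_(x in T) c)); last first.
  by rewrite sum_nat_const mulnC leq_mul2l card_exceptional orbT.
rewrite big_mkcond [leqRHS]big_mkcond; apply: leq_sum => x _ /=.
case: ifP => // xC; case: ifPn => xT.
  rewrite -(Hc x) big_mkcond [leqRHS]big_mkcond; apply: leq_sum => y _ /=.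
  by case: (same_side O x y); rewrite ?andbF ?andbT //; case: ifP.
rewrite leqn0 sum_nat_eq0; apply/forallP => y; apply/implyP => /andP[yC xy].
rewrite -leqn0 leqNgt; apply/negP; rewrite Hund => yx.
have := notLR disLR x.
move: xC yC xy; rewrite !inE /same_side => xC /orP[] /andP[].
  move=> /neighbour_of_left /(_ yx xT) xR yO /eqP xO.
  by move: xC; rewrite xO xR yO /= andbT orbF => ->.
move=> yO /neighbour_of_right /(_ yx xT) xL /eqP xO.
by move: xC; rewrite xO xL (negPf yO) /= => ->.
Qed.

Lemma vert_bound : h * #|L :|: R|%:R <= 135%:R * b%:R.
Proof.
rewrite leNgt; apply/negP => hlt.
have [x0 x0D] := set0Pn _ LR0.
have n0 : (0 < n)%N by apply/card_gt0P; exists x0.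
have h0 : 0 <= h.
  by apply: min_over_ge0 => S _; rewrite divr_ge0 ?ler0n.
have hn : 135%:R * b%:R < h * n%:R.
  by apply: lt_le_trans hlt (ler_wpM2l h0 _); rewrite ler_nat max_card.
have HD : (2 * #|~: (L :|: R)| <= n)%N.
  rewrite leqNgt; apply/negP => W2.
  have D2 : (2 * #|L :|: R| <= n)%N by have := cardsC (L :|: R); lia.
  have hD : h * #|L :|: R|%:R <= b%:R.
    by apply: le_trans (vert_cheeger_le D2) _; rewrite ler_nat leq_addl.
  move: (lt_le_trans hlt hD); rewrite -natrM ltr_nat; lia.
have HW : (45 * #|~: (L :|: R)| <= n)%N.
  have eb : (#|vert_boundary (L :|: R)| <= 1 * b)%N by rewrite mul1n leq_addl.
  by have [|] := vert_size_dichotomy hn eb; have := cardsC (L :|: R); lia.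
(* With k = 3 the two alternatives give 135/3 = 45 and 135/9 = 15; the weaker one is kept. *)
have HA g : g \in biautomorphisms Gam ->
    (15 * #|side_preserved L R g| <= n)%N \/ (15 * #|~: side_preserved L R g| <= n)%N.
  move=> gH; have [|] := vert_size_dichotomy hn (vert_boundary_side_preserved gH).
    by left; lia.
  by right; lia.
have [O [c [Hc HC]]] := almost_invariant_sides Hund Htr disLR n0 HW HA.
have c0 := same_side_degree_gt0 Hc Hnb.
have bn : (135 * b < 2 * n)%N.
  rewrite -(ltr_nat rat) !natrM; apply: lt_le_trans hn _.
  by apply: ler_wpM2r (vert_cheeger_le2 Gam); exact: ler0n.
have := same_side_count L R Hund Hc.
have := same_side_edges_le_vert Hc.
set k := #|_| in HC *; move: (\sum_(x in _) _)%N => E le1 le2.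
(* Here [c] cancels, so no degree enters: n <= 2k + b is impossible with 9k <= 2n and 135b < 2n. *)
have : (c * n <= c * (2 * k + b))%N by lia.
rewrite (leq_pmul2l c0); lia.
Qed.

End VertBound.

(** * Passing to the minima *)

Lemma ler_div_scale (h c d x b : rat) :
  0 < c -> 0 < d -> 0 < x -> h * x <= c * b -> h / (c * d) <= b / (d * x).
Proof.
move=> c0 d0 x0 hx; rewrite ler_pdivrMr ?mulr_gt0 // mulrAC ler_pdivlMr ?mulr_gt0 //.
by rewrite mulrCA (_ : b * (c * d) = d * (c * b)) ?ler_pM2l //; ring.
Qed.

Theorem theorem1p1 (Gam : mgraph) (d : nat)
    (Hclass : is_cayley_sum_graph Gam \/ is_twisted_cayley_graph Gam \/
              is_twisted_cayley_sum_graph Gam \/ vertex_transitive Gam)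
    (Hdeg : regular Gam d)
    (Hund : undirected Gam)
    (Hnonbip : ~ bipartite Gam) :
  edge_bipartiteness Gam d >= edge_cheeger Gam d / (90%:R * d%:R) /\
  vert_bipartiteness Gam >= vert_cheeger Gam / 135%:R.
Proof.
have Htr := bitransitive_class Hclass.
have d0 := degree_gt0 Hdeg Hnonbip.
(* An admissible pair exists because the empty graph is bipartite; both minima are therefore
   attained. *)
have pair0 : bip_pair (setT, set0 : {set Gam}).
  rewrite /bip_pair /= setU0; apply/andP; split.
    by rewrite -setI_eq0 setI0 eqxx.
  apply/negP => /eqP T0; apply: Hnonbip; exists set0 => x.
  by have := in_setT x; rewrite T0 inE.
split; rewrite /edge_bipartiteness /vert_bipartiteness.
  have [[L R] /andP[/= disLR LR0] ->] := min_over_attained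
    (fun LR : {set Gam} * {set Gam} => beta_edge d LR.1 LR.2) pair0.
  rewrite /beta_edge /= natrM; apply: ler_div_scale.
  - by rewrite (ltr0n rat 90).
  - by rewrite ltr0n.
  - by rewrite ltr0n card_gt0.
  - exact: edge_bound.
have [[L R] /andP[/= disLR LR0] ->] := min_over_attained
  (fun LR : {set Gam} * {set Gam} => beta_vert LR.1 LR.2) pair0.
(* The vertex case is the scaling lemma with 1 in place of the degree. *)
rewrite /beta_vert /= -[135%:R]mulr1 -[X in _ <= _ / X]mul1r.
apply: ler_div_scale.
- by rewrite (ltr0n rat 135).
- exact: ltr01.
- by rewrite ltr0n card_gt0.
- exact: vert_bound.
Qed.
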